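(* Let $p \geq 5$ be a prime. Then the fourth smallest nonzero Hamming weight of $C_p$ is $3p-3$ (the four smallest nonzero weights being $p+1, 2p, 2p+1, 3p-3$). Moreover, the only words of $C_p$ of Hamming weight $< 3p-3$ are the $\mathbb{F}_p$-linear combinations of at most two lines of $\pi_p$.
   Context: Let $p$ be a prime, $\mathbb{F}_p=\mathbb{Z}/p\mathbb{Z}$, and $\pi_p$ the projective plane over $\mathbb{F}_p$ with point set $P$. Let $V_p=\mathbb{F}_p^P$ be the space of functions $P\to\mathbb{F}_p$. Each line $\ell$ of $\pi_p$ is identified with its indicator function in $V_p$. The code $C_p$ is the $\mathbb{F}_p$-subspace of $V_p$ spanned by all lines; its elements are called words. The support of $w\in V_p$ is $\{x\in P: w(x)\neq 0\}$ and the Hamming weight $|w|$ is the size of the support. *)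

(* Defs.v *)
From HB Require Import structures.
From mathcomp Require Import all_boot all_order all_algebra.

Set Implicit Arguments.
Unset Strict Implicit.
Unset Printing Implicit Defensive.

Import GRing.Theory.
Local Open Scope ring_scope.

(* The library equips {vspace vT} only with a choiceType structure; over a
   finite field it is finite, being a subtype of a type of matrices. *)
Section FiniteVspace.
Import VectorInternalTheory.
Variables (F : finFieldType) (vT : vectType F).

HB.instance Definition _ := [Countable of {vspace vT} by <:].
HB.instance Definition _ := [Finite of {vspace vT} by <:].

End FiniteVspace.

Section ProjectivePlane.

(* 'F_p is the field Z/pZ only when p is prime. *)
Variable p : nat.

Definition point : finType := {U : {vspace 'rV['F_p]_3} | \dim U == 1%N}.
Definition line : finType := {U : {vspace 'rV['F_p]_3} | \dim U == 2}.

Definition incident (x : point) (l : line) : bool := (val x <= val l)%VS.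

(* ('F_p)^o is 'F_p viewed as a vector space over itself. *)
Definition fspace := {ffun point -> ('F_p)^o}.

HB.instance Definition _ := Finite.on fspace.
HB.instance Definition _ := Vector.on fspace.

Definition line_fun (l : line) : fspace := [ffun x => (incident x l)%:R].

Definition code : {vspace fspace} := <<[seq line_fun l | l : line]>>%VS.

Definition hweight (w : fspace) : nat := #|[set x | w x != 0]|.

(* The distinct weights of the nonzero words, in increasing order; the k-th
   smallest nonzero weight is the entry of index k - 1. *)
Definition nonzero_weights : seq nat :=
  sort leq (undup [seq hweight w | w : fspace in [pred w | w \in code & w != 0]]).

Definition comb_of_lines (k : nat) (w : fspace) : Prop :=
  exists (S : {set line}) (c : line -> 'F_p),
    (#|S| <= k)%N /\ w = \sum_(l in S) c l *: line_fun l.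

End ProjectivePlane.

(* Main.v *)
Require Import Defs.
From mathcomp Require Import all_boot all_order all_algebra.
From mathcomp Require Import ring zify.

(** Fix a word [w] of weight less than [3p-3] and a point [P].  On the line
    through [P] of slope [i], the values of [w] off [P] have moments [M_k(i)]
    which, for [k <= p-2], are given by a form of degree [k] in [i]: a line
    missing [P] contributes the [k]-th power of a linear form and a line
    through [P] contributes [0].  So each [M_k] vanishes identically or on at
    most [k] lines through [P].  Looking at the first [M_k] that is not
    identically zero, a Vandermonde argument bounds from below the number of
    support points on the lines through [P]; since the weight is small, either
    the support of [w] lies on two lines, or [P] lies on very few lines meeting
    the support in at most two points (precisely: at most one line with no
    further support point, or at most two with exactly one).  If the latter
    held for every [P], counting the incident pairs formed by a point and a
    line carrying one or two support points would give a contradiction.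

    A word of weight [3p-3] takes the values [y], [y], [-y] on three concurrent
    lines with coordinate [y]; it is obtained by summing the lines
    [y = a x + b z] for which adding the residues [a] and [b] produces a carry,
    and correcting by lines through the common point. *)

Set Implicit Arguments.
Unset Strict Implicit.
Unset Printing Implicit Defensive.

Import GRing.Theory.
Local Open Scope ring_scope.

(** * Coordinates around a point *)

(* The height at which the line [y = q.1 x + q.2 z] meets the line of slope [i]
   through the centre [(0:1:0)]; [Some t] stands for [(x, z) = (1, t)] and
   [None] for [(x, z) = (0, 1)]. *)
Definition slope_eval (F : nzRingType) (i : option F) (q : F * F) : F :=
  if i is Some t then q.1 + t * q.2 else q.2.

(** Affine coordinates centred at [P]: a point other than [P] has a slope and a height, and a line
    missing [P] is the graph of its heights. These incidence rules let the counting arguments avoid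
    subspaces. *)
Record frame (p : nat) (P : point p) := Frame {
  pencil : option 'F_p -> line p;
  fpoint : option 'F_p -> 'F_p -> point p;
  fline : 'F_p * 'F_p -> line p;
  pencil_inj : injective pencil;
  pencil_incident : forall i, incident P (pencil i);
  pencil_onto : forall l, incident P l -> exists i, l = pencil i;
  fpoint_inj : forall i j y z, fpoint i y = fpoint j z -> i = j /\ y = z;
  fpoint_neq : forall i y, fpoint i y != P;
  fpoint_onto : forall X, X != P -> exists i y, X = fpoint i y;
  fline_incident : forall q, ~~ incident P (fline q);
  fline_onto : forall l, ~~ incident P l -> exists q, l = fline q;
  incident_pencil : forall i y j, incident (fpoint i y) (pencil j) = (i == j);
  incident_fline : forall i y q,
    incident (fpoint i y) (fline q) = (y == slope_eval i q)
}.

Section Plane.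
Variables (F : fieldType) (V : vectType F).

Lemma span2P (x y z : V) :
  reflect (exists a b, z = a *: x + b *: y) (z \in <<[:: x; y]>>%VS).
Proof.
rewrite span_cons span_seq1; apply: (iffP memv_addP).
  by case=> _ /vlineP[a ->] [_ /vlineP[b ->]] ->; exists a, b.
case=> a [b ->]; exists (a *: x); first by rewrite memvZ ?memv_line.
by exists (b *: y); rewrite ?memvZ ?memv_line.
Qed.

Lemma dim_span2 (x y : V) :
  (forall a b, a *: x + b *: y = 0 -> a = 0 /\ b = 0) ->
  \dim <<[:: x; y]>> = 2.
Proof.
move=> xyP; have /eqP // : free [tuple x; y].
apply/freeP=> k; rewrite big_ord_recl big_ord1 /= => /xyP[k0 k1] i.
by case: i => [[|[|//]] Hi]; [rewrite -[RHS]k0 | rewrite -[RHS]k1];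
  congr k; apply: val_inj.
Qed.

Lemma vline_scale (k : F) (v : V) : k != 0 -> <[k *: v]>%VS = <[v]>%VS.
Proof.
move=> k0; apply/eqP; rewrite eqEsubv -!memvE memvZ ?memv_line //=.
by apply/vlineP; exists k^-1; rewrite scalerK.
Qed.

Lemma vline_pick (U : {vspace V}) :
  \dim U = 1 -> vpick U != 0 /\ U = <[vpick U]>%VS.
Proof.
move=> dU; have nz : vpick U != 0.
  by rewrite vpick0; apply: contra_eq_neq dU => ->; rewrite dimv0.
by split=> //; apply/esym/eqP; rewrite eqEdim -memvE memv_pick dim_vline nz dU.
Qed.

End Plane.

Section FrameOfBasis.
Variables (p : nat) (P : point p) (e u u' : 'rV['F_p]_3).
Hypothesis P_def : val P = <[e]>%VS.
Hypothesis basis_span : forall v : 'rV['F_p]_3, 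
  exists a b y : 'F_p, v = a *: u + b *: u' + y *: e.
Hypothesis basis_inj : forall a b y a' b' y' : 'F_p,
  a *: u + b *: u' + y *: e = a' *: u + b' *: u' + y' *: e ->
  [/\ a = a', b = b' & y = y'].

Lemma basis_zero (a b y : 'F_p) :
  a *: u + b *: u' + y *: e = 0 -> [/\ a = 0, b = 0 & y = 0].
Proof. by move=> H; apply: basis_inj; rewrite H !scale0r !addr0. Qed.

Definition dir (i : option 'F_p) : 'rV['F_p]_3 :=
  if i is Some t then u + t *: u' else u'.

Definition dir1 (i : option 'F_p) : 'F_p := (isSome i)%:R.
Definition dir2 (i : option 'F_p) : 'F_p := if i is Some t then t else 1.

Lemma dirE i : dir i = dir1 i *: u + dir2 i *: u'.
Proof.
by case: i => [t|]; rewrite /dir1 /= ?scale1r ?scale0r ?add0r ?mulr1n ?scale1r.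
Qed.

Lemma dir_inj i j y z (r : 'F_p) :
  dir i + y *: e = r *: dir j + z *: e -> [/\ i = j, r = 1 & y = z].
Proof.
rewrite !dirE scalerDr !scalerA => /basis_inj[].
rewrite /dir1 /dir2; case: i j => [t|] [s|] //=; rewrite ?mulr1 ?mulr0.
- by move<-; rewrite mul1r => -> ->.
- by move/eqP; rewrite oner_eq0.
- by move<-; rewrite mul0r => /eqP; rewrite oner_eq0.
- by move=> _ <- ->.
Qed.

Lemma normalize (a b : 'F_p) : (a != 0) || (b != 0) ->
  exists i r, r != 0 /\ a *: u + b *: u' = r *: dir i.
Proof.
have [->|a0] := eqVneq a 0 => /= [b0|_].
  by exists None, b; rewrite scale0r add0r.
exists (Some (b / a)), a; split=> //=.
by rewrite scalerDr scalerA mulrCA divff // mulr1.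
Qed.

Lemma fpoint_dim i y : \dim <[dir i + y *: e]> == 1%N.
Proof.
rewrite dim_vline eqb1 dirE; apply/eqP => /basis_zero[].
by rewrite /dir1 /dir2; case: i => [t|] /= /eqP; rewrite ?oner_eq0.
Qed.

Lemma pencil_dim i : \dim <<[:: e; dir i]>> == 2.
Proof.
apply/eqP/dim_span2 => a b; rewrite dirE addrC scalerDr !scalerA => /basis_zero[].
rewrite /dir1 /dir2; case: i => [t|] /=; rewrite ?mulr1 ?mulr0.
  by move=> -> _ ->.
by move=> _ -> ->.
Qed.

Lemma fline_dim (q : 'F_p * 'F_p) :
  \dim <<[:: u + q.1 *: e; u' + q.2 *: e]>> == 2.
Proof.
apply/eqP/dim_span2 => a b H.
have /basis_zero[] // : a *: u + b *: u' + (a * q.1 + b * q.2) *: e = 0.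
by apply: etrans H; apply/rowP=> k; rewrite !mxE; ring.
Qed.

Definition bpencil i : line p :=
  exist (fun U : {vspace 'rV['F_p]_3} => \dim U == 2) _ (pencil_dim i).
Definition bpoint i y : point p :=
  exist (fun U : {vspace 'rV['F_p]_3} => \dim U == 1%N) _ (fpoint_dim i y).
Definition bline q : line p :=
  exist (fun U : {vspace 'rV['F_p]_3} => \dim U == 2) _ (fline_dim q).

Lemma bincident_pencil i y j : incident (bpoint i y) (bpencil j) = (i == j).
Proof.
rewrite /incident /= -memvE; apply/span2P/eqP => [[a [b H]]|<-].
  by case: (@dir_inj i j y a b) => //; apply: etrans H _; rewrite addrC.
by exists y, 1; rewrite scale1r addrC.
Qed.

Lemma bincident_line i y q :
  incident (bpoint i y) (bline q) = (y == slope_eval i q).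
Proof.
rewrite /incident /= -memvE; apply/span2P/eqP => [[a [b H]]|->].
  have /basis_inj[] : dir1 i *: u + dir2 i *: u' + y *: e
      = a *: u + b *: u' + (a * q.1 + b * q.2) *: e.
    by rewrite -dirE H; apply/rowP=> k; rewrite !mxE; ring.
  by rewrite /dir1 /dir2; case: i {H} => [t|] /= <- <- ->; ring.
exists (dir1 i), (dir2 i); rewrite /dir1 /dir2.
by case: i => [t|] /=; apply/rowP=> k; rewrite !mxE; ring.
Qed.

Lemma bpencil_incident i : incident P (bpencil i).
Proof.
rewrite /incident P_def -memvE; apply/span2P.
by exists 1, 0; rewrite scale1r scale0r addr0.
Qed.

Lemma bline_incident q : ~~ incident P (bline q).
Proof.
rewrite /incident P_def -memvE; apply/span2P => [[a [b H]]].
have : 0 *: u + 0 *: u' + 1 *: e = a *: u + b *: u' + (a * q.1 + b * q.2) *: e.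
  by rewrite scale1r !scale0r !add0r {1}H; apply/rowP=> k; rewrite !mxE; ring.
by move/basis_inj => [<- <-] /eqP; rewrite !mul0r addr0 oner_eq0.
Qed.

Lemma bpoint_onto X : X != P -> exists i y, X = bpoint i y.
Proof.
have [nz XE] := vline_pick (eqP (valP X)).
have [a [b [y vE]]] := basis_span (vpick (val X)).
move=> XP; have /normalize[i [r [r0 E]]] : (a != 0) || (b != 0).
  rewrite -negb_and; apply: contra XP => /andP[/eqP a0 /eqP b0].
  apply/eqP/val_inj; rewrite /= P_def XE vE a0 b0 !scale0r !add0r vline_scale //.
  by apply: contra nz => /eqP y0; rewrite vE a0 b0 y0 !scale0r !add0r.
exists i, (r^-1 * y); apply/val_inj.
rewrite [LHS]XE vE E /= -[RHS](vline_scale _ r0).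
by rewrite scalerDr scalerA mulVKf.
Qed.

Lemma line_sub_eq (l m : line p) : (val l <= val m)%VS -> m = l.
Proof.
move=> lm; apply/esym/val_inj/eqP; rewrite eqEdim lm /=.
by rewrite (eqP (valP l)) (eqP (valP m)).
Qed.

Lemma bpencil_onto l : incident P l -> exists i, l = bpencil i.
Proof.
rewrite /incident P_def -memvE => el.
have : ~~ (val l <= <[e]>)%VS.
  apply/negP=> /dimvS; rewrite (eqP (valP l)) -P_def (eqP (valP P)) //.
case/subvPn => v vl; have [a [b [y vE]]] := basis_span v => ve.
have /normalize[i [r [r0 E]]] : (a != 0) || (b != 0).
  rewrite -negb_and; apply: contra ve => /andP[/eqP a0 /eqP b0].
  by rewrite vE a0 b0 !scale0r !add0r memvZ ?memv_line.
exists i; apply/line_sub_eq/span_subvP => z.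
rewrite !inE => /orP[/eqP->//|/eqP->].
have -> : dir i = r^-1 *: (v - y *: e) by rewrite vE E addrK scalerK.
by rewrite memvZ // memvB // memvZ.
Qed.

(** Two planes of a three-dimensional space share a nonzero vector; its [dir i] component is
    nonzero, since otherwise [l] would contain [e]. *)
Lemma line_meets_pencil l i : ~~ incident P l ->
  exists y, dir i + y *: e \in val l.
Proof.
rewrite /incident P_def -memvE => el.
have : (val l :&: val (bpencil i))%VS != 0%VS.
  rewrite -dimv_eq0 -lt0n -(ltn_add2l (\dim (val l + val (bpencil i)))).
  rewrite dimv_sum_cap addn0.
  rewrite (eqP (valP l)) (eqP (valP (bpencil i))).
  by apply: leq_ltn_trans (dimvS (subvf _)) _; rewrite dimvf /dim /=.
rewrite -vpick0; set v := vpick _ => v0.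
have := memv_pick (val l :&: val (bpencil i))%VS; rewrite -/v memv_cap => /andP[vl].
case/span2P => s [r vE]; have [r0|r0] := eqVneq r 0.
  case/negP: el; move: v0 vl; rewrite vE r0 scale0r addr0 => s0.
  have s0' : s != 0 by apply: contraNneq s0 => ->; rewrite scale0r.
  by move=> /(memvZ s^-1); rewrite scalerK.
exists (r^-1 * s); have -> : dir i + (r^-1 * s) *: e = r^-1 *: v.
  by rewrite vE scalerDr scalerK // scalerA addrC.
exact: memvZ.
Qed.

Lemma bline_onto l : ~~ incident P l -> exists q, l = bline q.
Proof.
(* The heights at slope [0] and at infinite slope give two spanning vectors of the line. *)
move=> Pl; have [a al] := line_meets_pencil (Some 0) Pl.
have [b bl] := line_meets_pencil None Pl.
exists (a, b); apply/line_sub_eq/span_subvP => z.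
rewrite !inE => /orP[]/eqP-> //=.
by move: al; rewrite /= scale0r addr0.
Qed.

Lemma frame_of_basis : exists fr : frame P, True.
Proof.
unshelve (eexists (@Frame p P bpencil bpoint bline _ _ _ _ _ _ _ _ _ _)) => //.
- move=> i j ij; apply/eqP.
  by rewrite -(bincident_pencil i 0 j) -ij bincident_pencil.
- exact: bpencil_incident.
- exact: bpencil_onto.
- move=> i j y z E.
  have /eqP ij : i == j by rewrite -(bincident_pencil i y j) E bincident_pencil.
  split=> //; subst j; apply/eqP.
  (* This line has height [z] at slope [i], so it tells the heights [y] and [z] apart. *)
  have := bincident_line i y (if i is Some _ then (z, 0) else (0, z)).
  rewrite E bincident_line; case: {E} i => [t|] /=; rewrite ?mulr0 ?addr0 eqxx => <- //.
- move=> i y; apply/eqP=> E.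
  have := bincident_line i y (if i is Some _ then (y, 0) else (0, y)).
  rewrite E (negPf (bline_incident _)).
  by case: i {E} => [t|] /=; rewrite ?mulr0 ?addr0 eqxx.
- exact: bpoint_onto.
- exact: bline_incident.
- exact: bline_onto.
- exact: bincident_pencil.
- exact: bincident_line.
Qed.

End FrameOfBasis.

Lemma frame_exists p (P : point p) : exists fr : frame P, True.
Proof.
have [nz PE] := vline_pick (eqP (valP P)).
set e := vpick (val P) in nz PE.
have dC : \dim (val P)^C = 2 by rewrite dimv_compl (eqP (valP P)) dimvf /dim /=.
have sC : size (vbasis (val P)^C) = 2 by rewrite size_tuple.
case sE: (vbasis (val P)^C : seq _) sC => [|u [|u' [|]]] //= _.
have CE : ((val P)^C = <<[:: u; u']>>)%VS.
  by rewrite -sE; apply/esym/span_basis/vbasisP.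
have bs v : exists a b y, v = a *: u + b *: u' + y *: e.
  have : v \in (val P + (val P)^C)%VS by rewrite addv_complf memvf.
  case/memv_addP => x; rewrite CE PE => /vlineP[y ->] [z /span2P[a [b ->]] ->].
  by exists a, b, y; rewrite addrC.
apply: (frame_of_basis PE bs) => a b y a' b' y' E.
(* Three vectors spanning a space of dimension three are free. *)
have /andP[_ /(@freeP _ _ 3 [tuple u; u'; e]) fr] : basis_of fullv [:: u; u'; e].
  rewrite basisEdim dimvf /dim /= andbT; apply/subvP=> v _.
  have [c [d [z ->]]] := bs v.
  by rewrite !memvD // memvZ // memv_span // !inE eqxx ?orbT.
have /fr {}fr : \sum_(i < 3) [:: a - a'; b - b'; y - y']`_i *: [tuple u; u'; e]`_i = 0.
  rewrite !big_ord_recl big_ord0 /= addr0 -[RHS](subrr (a *: u + b *: u' + y *: e)).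
  by rewrite {2}E; apply/rowP=> k; rewrite !mxE; ring.
by split; apply/eqP; rewrite -subr_eq0; apply/eqP;
  [exact: (fr 0) | exact: (fr 1) | exact: (fr 2%:R)].
Qed.

(** * Moments along a pencil of lines *)

Lemma big_option (R : Type) (idx : R) (op : Monoid.com_law idx) (T : finType)
    (G : option T -> R) :
  \big[op/idx]_i G i = op (G None) (\big[op/idx]_t G (Some t)).
Proof.
rewrite (bigD1 None) //=; congr (op _ _).
rewrite (reindex_omap Some id) /=; last by case.
by apply: eq_bigl => t; rewrite eqxx.
Qed.

Lemma card_set_option (T : finType) (A : {set option T}) :
  #|A| = ((None \in A) + #|[set t | Some t \in A]|)%N.
Proof.
rewrite -!sum1_card big_mkcond big_option /=; congr (_ + _)%N.
by rewrite [RHS]big_mkcond; apply: eq_bigr => t _; rewrite inE.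
Qed.

Lemma sum_geq (I : finType) (m : nat) (A : {set I}) (e : I -> nat) :
  (forall i, i \in A -> (m <= e i)%N) -> (m * #|A| <= \sum_i e i)%N.
Proof.
move=> He; rewrite mulnC -sum_nat_const [leqRHS](bigID (mem A)) /=.
by apply: leq_trans (leq_addr _ _); apply: leq_sum.
Qed.

Lemma sum_le_cond_geq (I : finType) (m : nat) (A : {set I}) (e : I -> nat) :
  (0 < m)%N -> (forall i, 0 < e i)%N ->
  (forall i, i \in A -> (m <= e i)%N) -> (#|I| + m.-1 * #|A| <= \sum_i e i)%N.
Proof.
move=> m0 e0 He; rewrite mulnC -sum_nat_const -sum1_card big_mkcond.
rewrite [X in (_ + X)%N]big_mkcond /=.
rewrite -big_split; apply: leq_sum => i _ /=.
by case: ifP => [/He|_]; have := e0 i; lia.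
Qed.

Section Vanishing.
Variables (p : nat) (p_prime : prime p).

Lemma sum1_Fp : \sum_(y : 'F_p) 1 = 0 :> 'F_p.
Proof. by rewrite sumr_const card_Fp // pchar_Fp_0. Qed.

(** For [k > 0], [X^k - 1] has fewer than [p - 1] roots, so some [a != 0] has [a ^+ k != 1];
    multiplication by [a] permutes the field and scales the sum by [a ^+ k]. For [k = 0] the sum is
    [p], as [0 ^+ 0 = 1]. *)
Lemma sum_expr_eq0 k : (k < p.-1)%N -> \sum_(y : 'F_p) y ^+ k = 0.
Proof.
move=> kF; have [->|k0] := posnP k.
  by under eq_bigr do rewrite expr0; exact: sum1_Fp.
have /existsP[a /andP[a0 ak]] : [exists a : 'F_p, (a != 0) && (a ^+ k != 1)].
  rewrite -[X in is_true X]negbK negb_exists; apply/negP=> /forallP H.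
  have := @max_poly_roots _ ('X^k - 1 : {poly 'F_p}) (enum [set~ 0]).
  rewrite -size_poly_eq0 size_XnsubC // => /(_ isT).
  rewrite enum_uniq -cardE cardsC1 card_Fp //.
  have -> : all (root ('X^k - 1)) (enum [set~ (0 : 'F_p)]).
    apply/allP=> a; rewrite mem_enum !inE => a0; have := H a.
    by rewrite a0 /= negbK rootE !hornerE subr_eq0.
  by move=> /(_ isT isT); lia.
have E : a ^+ k * (\sum_(y : 'F_p) y ^+ k) = \sum_(y : 'F_p) y ^+ k.
  rewrite mulr_sumr [RHS](reindex_inj (mulfI a0)) /=.
  by apply: eq_bigr => y _; rewrite exprMn.
apply/eqP; move/eqP: E; rewrite -[X in _ == X]mul1r -subr_eq0 -mulrBl mulf_eq0.
by rewrite subr_eq0 (negPf ak).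
Qed.

(** The Vandermonde argument: if [g y0 != 0], the polynomial with roots at the other support points
    has degree less than [k], so [g] is orthogonal to it, yet only the nonzero term at [y0]
    survives. *)
Lemma moments_eq0 (F : finFieldType) (g : F -> F) k :
  (forall j, (j < k)%N -> \sum_y g y * y ^+ j = 0) ->
  (#|[set y | g y != 0%R]| <= k)%N -> forall y, g y = 0.
Proof.
move=> gM gk y0; apply/eqP; apply/negP=> /negP gy0.
pose q : {poly F} := \prod_(y in [set y | g y != 0] :\ y0) ('X - y%:P).
have sq : (size q <= k)%N.
  rewrite /q -big_enum size_prod_XsubC -cardE; apply: leq_trans gk.
  by rewrite [leqRHS](cardsD1 y0) inE gy0.
have : \sum_y g y * q.[y] = 0.
  under eq_bigr do rewrite (horner_coef_wide _ sq) mulr_sumr.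
  rewrite exchange_big big1 //= => j _.
  under eq_bigr do rewrite mulrCA.
  by rewrite -mulr_sumr gM ?mulr0.
rewrite (bigD1 y0) //= big1 ?addr0 => [/eqP|y yy0].
  rewrite mulf_eq0 (negPf gy0) horner_prod /= => /prodf_eq0[y].
  by rewrite !inE hornerXsubC subr_eq0 => /andP[/negPf yy0 _]; rewrite eq_sym yy0.
have [->|gy] := eqVneq (g y) 0; first by rewrite mul0r.
rewrite /q (bigD1 y) /= ?inE ?gy ?yy0 // hornerM hornerXsubC subrr.
by rewrite mul0r mulr0.
Qed.

(** [M] is a binary form of degree [k] on the projective line, with dehomogenization [f]. A zero at
    infinity means that the coefficient of degree [k] vanishes, which leaves room for one finite
    root fewer. *)
Lemma form_zeros (F : finFieldType) (f : {poly F}) k (M : option F -> F) :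
  (size f <= k.+1)%N -> (forall t, M (Some t) = f.[t]) -> M None = f`_k ->
  (forall i, M i = 0) \/ (#|[set i | M i == 0%R]| <= k)%N.
Proof.
move=> sf MS MN; have [f0|f0] := eqVneq f 0.
  by left=> -[t|]; rewrite ?MS ?MN f0 ?horner0 ?coef0.
right; rewrite card_set_option !inE MN.
have : (#|[set t | Some t \in [set i | M i == 0%R]]| < size f)%N.
  rewrite cardE; apply: max_poly_roots => //; last exact: enum_uniq.
  by apply/allP=> t; rewrite mem_enum !inE MS.
case: eqP => fk; rewrite ?add1n ?add0n; 
  last by move=> H; rewrite -ltnS (leq_trans H sf).
move=> H; apply: leq_trans H _.
apply/leq_sizeP => j; rewrite leq_eqVlt => /orP[/eqP<- //|kj].
by apply: (leq_sizeP _ _ sf).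
Qed.

End Vanishing.

Lemma coef_exp_affine (R : comNzRingType) (a b : R) k :
  (size ((a%:P + b *: 'X) ^+ k)%R <= k.+1)%N /\ ((a%:P + b *: 'X) ^+ k)`_k = b ^+ k.
Proof.
have sl : (size (a%:P + b *: 'X)%R <= 2)%N.
  rewrite (leq_trans (size_polyD _ _)) // geq_max (leq_trans (size_polyC_leq1 _)) //=.
  by rewrite (leq_trans (size_scale_leq _ _)) // size_polyX.
elim: k => [|k [sk ck]]; first by rewrite !expr0 size_poly1 coef1.
rewrite !exprS; split.
  by rewrite (leq_trans (size_polyMleq _ _)) //; lia.
rewrite mulrDl coefD coefCM -scalerAl coefZ coefXM /= ck.
by rewrite [X in a * X]nth_default ?mulr0 ?add0r.
Qed.

Section Pencil.
Variables (p : nat) (p_prime : prime p).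
Implicit Types (c : 'F_p * 'F_p -> 'F_p) (h : option 'F_p -> 'F_p).

(** Values off the centre of a combination of lines, with coefficients [h] on the lines through the
    centre and [c] on the others. *)
Definition pencil_fun c h i (y : 'F_p) : 'F_p :=
  h i + \sum_q c q * (y == slope_eval i q)%:R.

Definition moment (g : option 'F_p -> 'F_p -> 'F_p) k i := \sum_y g i y * y ^+ k.

Definition fibre_weight (g : option 'F_p -> 'F_p -> 'F_p) i :=
  #|[set y | g i y != 0]|.

(** The term [h i] is constant along the line of slope [i], so it is killed by the vanishing power
    sums. *)
Lemma moment_pencil_fun c h k i : (k < p.-1)%N ->
  moment (pencil_fun c h) k i = \sum_q c q * slope_eval i q ^+ k.
Proof.
move=> kp; rewrite /moment.
under eq_bigr do rewrite mulrDl mulr_suml.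
rewrite big_split /= -mulr_sumr sum_expr_eq0 // mulr0 add0r exchange_big /=.
apply: eq_bigr => q _; rewrite (bigD1 (slope_eval i q)) //= eqxx mulr1.
by rewrite big1 ?addr0 // => y /negPf->; rewrite mulr0 mul0r.
Qed.

Lemma moment_zeros c h k : (k < p.-1)%N ->
  (forall i, moment (pencil_fun c h) k i = 0) \/
  (#|[set i | moment (pencil_fun c h) k i == 0%R]| <= k)%N.
Proof.
move=> kp; pose f : {poly 'F_p} := \sum_q c q *: (q.1%:P + q.2 *: 'X) ^+ k.
apply: (@form_zeros _ f).
- rewrite (leq_trans (size_sum _ _ _)) //; apply/bigmax_leqP => q _.
  rewrite (leq_trans (size_scale_leq _ _)) ////.
  by have [] := coef_exp_affine q.1 q.2 k.
- move=> t; rewrite moment_pencil_fun // /f horner_sum; apply: eq_bigr => q _.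
  by rewrite hornerZ horner_exp hornerD hornerC hornerZ hornerX /= [t * _]mulrC.
- rewrite moment_pencil_fun // /f coef_sum; apply: eq_bigr => q _.
  by rewrite coefZ; have [_ ->] := coef_exp_affine q.1 q.2 k.
Qed.

Lemma card_pencil : #|{: option 'F_p}| = p.+1.
Proof. by rewrite card_option card_Fp. Qed.

Lemma moment_nonzeros c h k : (k < p.-1)%N ->
  ~ (forall i, moment (pencil_fun c h) k i = 0) ->
  (p.+1 - k <= #|[set i | moment (pencil_fun c h) k i != 0%R]|)%N.
Proof.
move=> kp nz; have [//|zk] := moment_zeros c h kp.
rewrite -card_pencil -(cardsC [set i | moment (pencil_fun c h) k i == 0]).
rewrite leq_subLR; apply: leq_add => //; apply: subset_leq_card.
by apply/subsetP=> i; rewrite !inE.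
Qed.

(** Order zero is left out because the moment of order zero is nonzero in the application with
    [k0 = 2]. *)
Lemma first_nonzero_moment c h k0 : (0 < k0)%N ->
  (forall j i, (0 < j < k0)%N -> moment (pencil_fun c h) j i = 0) ->
  (forall j i, (0 < j < p.-1)%N -> moment (pencil_fun c h) j i = 0) \/
  exists k, [/\ (k0 <= k)%N, (k < p.-1)%N,
    forall j i, (0 < j < k)%N -> moment (pencil_fun c h) j i = 0 &
    ~ (forall i, moment (pencil_fun c h) k i = 0)].
Proof.
move=> k0_gt0 Mk0; pose nz k := (0 < k < p.-1)%N &&
  [exists i, moment (pencil_fun c h) k i != 0].
have [/existsP[k nzk]|] := boolP [exists k : 'I_p.-1, nz k]; last first.
  rewrite negb_exists => /forallP Mz; left=> j i /andP[j0 jp].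
  have := Mz (Ordinal jp); rewrite /nz /= j0 jp negb_exists.
  by move=> /forallP/(_ i)/negbNE/eqP.
right; case: (ex_minnP (ex_intro nz _ nzk)) => {nzk}k.
case/andP => /andP[k_gt0 kp] /existsP[i nzi] kmin; exists k; split=> //.
- by rewrite leqNgt; apply: contra nzi => kk0; rewrite Mk0 // k_gt0.
- move=> j i' /andP[j0 jk]; apply/eqP/negPn/negP => nzj.
  have := kmin j; rewrite /nz j0 (ltn_trans jk kp) leqNgt jk /= => H.
  by apply: notF; apply: H; apply/existsP; exists i'.
- by move=> Mz; rewrite Mz eqxx in nzi.
Qed.

(** The moment of order zero vanishes. If all moments up to order [p - 2] do, a nonempty fibre is
    full, so there are at most two. Otherwise let [k] be the first order with a nonzero moment: if
    [k = 1], empty fibres are zeros of a linear form; if [k >= 2], at least [p + 1 - k] fibres have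
    [k + 1] points or more. *)
Lemma isotropic_pencil c h :
  let e := fibre_weight (pencil_fun c h) in
  (5 <= p)%N -> \sum_q c q = 0 -> (\sum_i e i < 3 * p - 3)%N ->
  (#|[set i | e i == 0%N]| <= 1)%N \/ (#|[set i | e i != 0%N]| <= 2)%N.
Proof.
set g := pencil_fun c h => e p5 c0 eN.
have e_ge k i : (forall j, (j < k)%N -> moment g j i = 0) -> e i != 0%N -> (k < e i)%N.
  move=> gk ei; rewrite ltnNge; apply: contra ei => /(moments_eq0 gk) g0.
  by rewrite /e /fibre_weight cards_eq0; apply/eqP/setP=> y; rewrite !inE g0 eqxx.
have eM k i : moment g k i != 0 -> e i != 0%N.
  apply: contraNneq => /eqP; rewrite cards_eq0 => /eqP/setP g0.
  apply/eqP/big1 => y _; have := g0 y; rewrite !inE => /negbFE/eqP->.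
  by rewrite mul0r.
have M0 i : moment g 0 i = 0.
  rewrite moment_pencil_fun; last by lia.
  by under eq_bigr do rewrite expr0 mulr1.
have [j i|Mp|[k [k1 kp Mk nzk]]] := @first_nonzero_moment c h 1 isT.
- by lia.
- have {}Mp j i : (j < p.-1)%N -> moment g j i = 0 by case: j => [|j] // jp; apply: Mp.
  right; have : (p * #|[set i | e i != 0%N]| <= \sum_i e i)%N.
    by apply: sum_geq => i; rewrite inE => /(e_ge p.-1 _ (fun j => Mp j i)); lia.
  by move: (#|_|) => m; nia.
have {}Mk j i : (j < k)%N -> moment g j i = 0 by case: j => [|j] // jk; apply: Mk.
have le_k := moment_nonzeros kp nzk.
have [k2|k2] := leqP k 1.
  left; have k1' : k = 1%N by lia.
  have [//|zk] := moment_zeros c h kp.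
  apply: leq_trans (leq_trans zk k2); apply: subset_leq_card; apply/subsetP=> i.
  by rewrite !inE => /eqP ei; apply: contraT => /eM; rewrite ei.
exfalso.
have : (k.+1 * #|[set i | moment g k i != 0%R]| <= \sum_i e i)%N.
  by apply: sum_geq => i; rewrite inE => /eM; apply: e_ge => j; apply: Mk.
(* The product [(k + 1) * (p + 1 - k)] is concave in [k] and equals [3p - 3] at both ends [k = 2]
   and [k = p - 2]. *)
by move: le_k; rewrite -/g; nia.
Qed.

(** The nonzero moment of order zero makes every fibre nonempty. Let [A] be the set of slopes with a
    support point of nonzero height, and [k] the first positive order with a nonzero moment, or
    [p - 1] if there is none: fibres over [A] have at least [k] points. For [k = 2], fibres with one
    point are zeros of a quadratic form; for [3 <= k <= p - 2] the total weight is too large; for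
    [k = p - 1] it forces [A] to have at most one element. *)
Lemma centered_pencil c h :
  let g := pencil_fun c h in
  let e := fibre_weight g in
  (5 <= p)%N -> \sum_q c q != 0 -> (forall i, moment g 1 i = 0) ->
  (\sum_i e i < 3 * p - 3)%N ->
  (#|[set i | e i == 1%N]| <= 2)%N \/
  (#|[set i | [exists y, (y != 0%R) && (g i y != 0%R)]]| <= 1)%N.
Proof.
move=> g e p5 c0 M1 eN.
pose A := [set i | [exists y, (y != 0) && (g i y != 0)]].
have e_gt0 i : (0 < e i)%N.
  rewrite lt0n; apply: contraNneq c0 => /eqP; rewrite cards_eq0 => /eqP/setP g0.
  have -> : \sum_q c q = moment g 0 i.
    rewrite moment_pencil_fun; last by lia.
    by apply: eq_bigr => q _; rewrite expr0 mulr1.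
  by apply/eqP/big1 => y _; have := g0 y; rewrite !inE => /negbFE/eqP->; rewrite mul0r.
have e_ge k i : (forall j, (0 < j < k)%N -> moment g j i = 0) -> i \in A -> (k <= e i)%N.
  case: k => // k gk; rewrite inE => /existsP[y /andP[y0 gy]].
  rewrite ltnNge; apply/negP => ek.
  (* Multiplying by the height shifts the moments by one order, which discards the moment of order
     zero. *)
  have /moments_eq0 : forall j, (j < k)%N -> \sum_y (g i y * y) * y ^+ j = 0.
    move=> j jk; rewrite -[RHS](gk j.+1) //.
    by apply: eq_bigr => z _; rewrite exprS mulrA.
  move=> H; have /H/(_ y)/eqP : (#|[set z | (g i z * z)%R != 0%R]| <= k)%N.
    apply: leq_trans ek; apply: subset_leq_card; apply/subsetP=> z.
    by rewrite !inE mulf_eq0 negb_or => /andP[].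
  by rewrite mulf_eq0 (negPf y0) (negPf gy).
have eM k i : (0 < k)%N -> moment g k i != 0 -> i \in A.
  move=> k0; apply: contraR; rewrite inE negb_exists => /forallP gz.
  apply/eqP/big1 => y _; have := gz y; rewrite negb_and !negbK => /orP[]/eqP->.
    by rewrite expr0n gtn_eqF // mulr0.
  by rewrite mul0r.
have [j i|Mp|[k [k1 kp Mk nzk]]] := @first_nonzero_moment c h 2 isT.
- by case: j => [|[]].
- right; have := @sum_le_cond_geq _ p.-1 A e _ e_gt0.
  rewrite card_pencil => H; have : (p.+1 + p.-1.-1 * #|A| <= \sum_i e i)%N.
    by apply: H => [|i]; [lia | apply: e_ge => j; apply: Mp].
  by move: (#|A|) => m; nia.
have le_k := moment_nonzeros kp nzk.
have AM : [set i | moment g k i != 0] \subset A.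
  by apply/subsetP=> i; rewrite inE; apply: eM; lia.
have ge_k i : i \in A -> (k <= e i)%N by apply: e_ge => j; apply: Mk.
have [k2|k2] := leqP k 2.
  left; have k2' : k = 2 by lia.
  have [//|zk] := moment_zeros c h kp.
  apply: leq_trans (leq_trans zk k2); apply: subset_leq_card; apply/subsetP=> i.
  rewrite !inE => /eqP ei; apply: contraT => Hi.
  have := ge_k i (eM k i (ltnW k1) Hi); by rewrite ei k2'.
exfalso; have := @sum_le_cond_geq _ k A e _ e_gt0 ge_k; rewrite card_pencil.
have : (p.+1 - k <= #|A|)%N by apply: leq_trans le_k (subset_leq_card AM).
by move: (#|A|) => m; nia.
Qed.

(* Translating the slopes by the centre of mass of [c] makes the first
   moments vanish. *)
Lemma anisotropic_pencil c h :
  let g := pencil_fun c h in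
  let e := fibre_weight g in
  (5 <= p)%N -> \sum_q c q != 0 -> (\sum_i e i < 3 * p - 3)%N ->
  (#|[set i | e i == 1%N]| <= 2)%N \/
  exists s, (#|[set i | [exists y, (y != slope_eval i s) && (g i y != 0%R)]]| <= 1)%N.
Proof.
move=> g e p5 d0 eN; set d := \sum_q c q in d0.
pose s : 'F_p * 'F_p := ((\sum_q c q * q.1) / d, (\sum_q c q * q.2) / d).
pose c' q := c (q + s).
have evD i (q r : 'F_p * 'F_p) : slope_eval i (q + r) = slope_eval i q + slope_eval i r.
  by case: i => [t|] //=; ring.
have gE i y : pencil_fun c' h i y = g i (y + slope_eval i s).
  rewrite /g /pencil_fun; congr (_ + _); rewrite [RHS](reindex_inj (addIr s)) /=.
  by apply: eq_bigr => q _; rewrite evD (inj_eq (addIr _)).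
have eE i : fibre_weight (pencil_fun c' h) i = e i.
  rewrite /e /fibre_weight -[RHS](card_imset _ (addIr (- slope_eval i s))).
  congr #|pred_of_set _|; apply/setP=> y; rewrite inE gE.
  apply/idP/imsetP => [gy|[z]]; last by rewrite inE => gz ->; rewrite subrK.
  by exists (y + slope_eval i s); rewrite ?inE // addrK.
have c'E : \sum_q c' q = d by rewrite /d [RHS](reindex_inj (addIr s)).
have M1 i : moment (pencil_fun c' h) 1 i = 0.
  rewrite moment_pencil_fun; last by lia.
  have -> : \sum_q c' q * slope_eval i q ^+ 1 =
      \sum_q c q * slope_eval i q - d * slope_eval i s.
    rewrite [X in _ = X - _](reindex_inj (addIr s)) -c'E mulr_suml -sumrB.
    by apply: eq_bigr => q _; rewrite evD /c' /=; ring.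
  have s1 : d * s.1 = \sum_q c q * q.1 by rewrite mulrC divfK.
  have s2 : d * s.2 = \sum_q c q * q.2 by rewrite mulrC divfK.
  case: i => [t|]; rewrite /slope_eval; last by rewrite s2 subrr.
  rewrite mulrDr [d * (t * _)]mulrCA s1 s2 mulr_sumr -big_split /= -sumrB big1 // => q _.
  by ring.
have [|||] := @centered_pencil c' h p5 _ M1.
- by rewrite c'E.
- by under eq_bigr do rewrite eE.
- by move=> H; left; under eq_finset do rewrite -eE.
(* Height zero in the translated coordinates is the line [s] in the original ones. *)
- move=> H; right; exists s; apply: leq_trans H; apply: subset_leq_card.
  apply/subsetP=> i; rewrite !inE => /existsP[y /andP[ys gy]].
  apply/existsP; exists (y - slope_eval i s); rewrite gE subrK gy andbT.
  by rewrite subr_eq0.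
Qed.

End Pencil.

(** * Words of the code *)

Section FrameTheory.
Variables (p : nat) (P : point p) (fr : frame P).

Section Big.
Variables (R : Type) (idx : R) (op : Monoid.com_law idx).

Lemma fline_inj : injective (fline fr).
Proof.
move=> [a b] [a' b'] E.
have := incident_fline fr None b (a, b); rewrite E incident_fline /= eqxx => /eqP bb.
have := incident_fline fr (Some 0) a (a, b).
rewrite E incident_fline /= !mul0r !addr0 eqxx => /eqP aa.
by rewrite aa bb.
Qed.

Lemma big_pencil (G : line p -> R) :
  \big[op/idx]_(l | incident P l) G l = \big[op/idx]_i G (pencil fr i).
Proof.
rewrite -(big_imset _ (in2W (@pencil_inj _ _ fr))) /=; apply: eq_bigl => l.
apply/idP/imsetP => [/(pencil_onto fr)[i ->]|[i _ ->]]; first by exists i.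
exact: pencil_incident.
Qed.

Lemma big_lines (G : line p -> R) :
  \big[op/idx]_l G l
    = op (\big[op/idx]_i G (pencil fr i)) (\big[op/idx]_q G (fline fr q)).
Proof.
rewrite (bigID (incident P)) big_pencil; congr (op _ _).
rewrite -[RHS](big_imset _ (in2W fline_inj)) /=; apply: eq_bigl => l.
apply/idP/imsetP => [/(fline_onto fr)[q ->]|[q _ ->]]; first by exists q.
exact: fline_incident.
Qed.

Lemma big_points (G : point p -> R) :
  \big[op/idx]_X G X = op (G P) (\big[op/idx]_i \big[op/idx]_y G (fpoint fr i y)).
Proof.
rewrite (bigD1 P) //=; congr (op _ _); rewrite pair_big /=.
have inj : {in predT &, injective (fun iy => fpoint fr iy.1 iy.2)}.
  by move=> [i y] [j z] _ _ /fpoint_inj[/= -> ->].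
rewrite -(big_imset _ inj) /=; apply: eq_bigl => X.
apply/idP/imsetP => [/(fpoint_onto fr)[i [y ->]]|[[i y] _ ->]].
  by exists (i, y).
exact: fpoint_neq.
Qed.

Lemma big_pencil_points i (G : point p -> R) :
  \big[op/idx]_(X | incident X (pencil fr i)) G X
    = op (G P) (\big[op/idx]_y G (fpoint fr i y)).
Proof.
rewrite big_mkcond big_points pencil_incident; congr (op _ _).
rewrite (bigD1 i) //= [X in op _ X]big1 ?Monoid.mulm1 => [|j /negPf ji].
  by apply: eq_bigr => y _; rewrite incident_pencil eqxx.
by apply: big1 => y _; rewrite incident_pencil ji.
Qed.

Lemma big_fline_points q (G : point p -> R) :
  \big[op/idx]_(X | incident X (fline fr q)) G X
    = \big[op/idx]_i G (fpoint fr i (slope_eval i q)).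
Proof.
rewrite big_mkcond big_points (negPf (fline_incident _ _)) Monoid.mul1m.
apply: eq_bigr => i _; rewrite (bigD1 (slope_eval i q)) //= incident_fline eqxx.
by rewrite big1 ?Monoid.mulm1 // => y /negPf yq; rewrite incident_fline yq.
Qed.

End Big.
End FrameTheory.

(** * Position of points and lines *)

Section Geometry.
Variable p : nat.

Lemma line_has_point (l : line p) : exists P, incident P l.
Proof.
have nz : vpick (val l) != 0.
  rewrite vpick0; apply: contraTneq (valP l) => /= ->; by rewrite dimv0.
have dP : \dim <[vpick (val l)]> == 1%N by rewrite dim_vline nz.
exists (exist (fun U : {vspace 'rV['F_p]_3} => \dim U == 1%N) _ dP).
by rewrite /incident /= -memvE memv_pick.
Qed.

(** Centring a frame at a common point turns both lines into lines of its pencil. *)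
Lemma lines_meet (l m : line p) :
  exists P (fr : frame P) i j, l = pencil fr i /\ m = pencil fr j.
Proof.
have [Q Ql] := line_has_point l; have [fr _] := frame_exists Q.
have [i lE] := pencil_onto fr Ql.
have [/(pencil_onto fr)[j mE]|/(fline_onto fr)[q mE]] := boolP (incident Q m).
  by exists Q, fr, i, j.
pose P := fpoint fr i (slope_eval i q); have [fr' _] := frame_exists P.
have [j lE'] : exists j, l = pencil fr' j.
  by apply: pencil_onto; rewrite lE incident_pencil.
have [k mE'] : exists j, m = pencil fr' j.
  by apply: pencil_onto; rewrite mE incident_fline.
by exists P, fr', j, k.
Qed.

Lemma exists_other_line (l : line p) : exists m, m != l.
Proof.
have [Q Ql] := line_has_point l; have [fr _] := frame_exists Q.
by exists (fline fr (0, 0)); apply: contraTneq Ql => <-; apply: fline_incident.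
Qed.

End Geometry.

(** Linear interpolation: points of distinct slopes are joined by a line missing the centre. *)
Lemma slope_eval_solve (F : fieldType) (i j : option F) (y z : F) : i != j ->
  exists q, slope_eval i q = y /\ slope_eval j q = z.
Proof.
case: i j => [t|] [s|] //= ij.
- have ts : t - s != 0 by rewrite subr_eq0; apply: contra ij => /eqP->.
  by exists (y - t * ((y - z) / (t - s)), (y - z) / (t - s)) => /=; split; field.
- by exists (y - t * z, z) => /=; split=> //; ring.
- by exists (z - s * y, y) => /=; split=> //; ring.
Qed.

Lemma card_le1_cover (T : finType) (x0 : T) (A : {set T}) : (#|A| <= 1)%N ->
  exists x, forall z, z \in A -> z = x.
Proof.
move=> /card_le1_eqP A1; have [->|[x xA]] := set_0Vmem A.
  by exists x0 => z; rewrite inE.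
by exists x => z zA; apply: A1.
Qed.

Lemma card_le2_cover (T : finType) (x0 : T) (A : {set T}) : (#|A| <= 2)%N ->
  exists x y, forall z, z \in A -> (z == x) || (z == y).
Proof.
have [->|[x xA]] := set_0Vmem A; first by exists x0, x0 => z; rewrite inE.
rewrite (cardsD1 x) xA => /(card_le1_cover x0)[y yA]; exists x, y => z zA.
by have [//|zx /=] := eqVneq z x; apply/eqP/yA; rewrite !inE zx.
Qed.

Section Words.
Variables (p : nat) (p_prime : prime p).
Implicit Types (w : fspace p) (l m : line p) (P Q : point p).

Lemma codeP w : reflect (exists c : line p -> 'F_p, w = \sum_l c l *: line_fun l)
  (w \in code p).
Proof.
apply: (iffP idP) => [wC|[c ->]]; last first.
  by apply: memv_suml => l _; rewrite memvZ // memv_span // map_f // mem_enum.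
pose X := [tuple of map (@line_fun p) (enum_tuple {: line p})].
have /coord_span wE : w \in <<X>>%VS by [].
exists (fun l => coord X (enum_rank l) w); rewrite {1}wE.
rewrite (reindex enum_rank) /=; last by apply: onW_bij; apply: enum_rank_bij.
apply: eq_bigr => l _; congr (_ *: _).
by rewrite (nth_map l) ?nth_enum_rank // -cardE ltn_ord.
Qed.

Lemma word_at_fpoint (c : line p -> 'F_p) P (fr : frame P) i y :
  (\sum_l c l *: line_fun l) (fpoint fr i y)
    = pencil_fun (c \o fline fr) (c \o pencil fr) i y.
Proof.
rewrite sum_ffunE /pencil_fun (big_lines fr) /=; congr (_ + _).
  rewrite (bigD1 i) //= big1 ?addr0 => [|j ji].
    by rewrite !ffunE incident_pencil eqxx mulr1n [_ *: _]mulr1.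
  by rewrite !ffunE incident_pencil eq_sym (negPf ji) scaler0.
by apply: eq_bigr => q _; rewrite !ffunE incident_fline.
Qed.

Lemma word_at_center (c : line p -> 'F_p) P (fr : frame P) :
  (\sum_l c l *: line_fun l) P = \sum_i c (pencil fr i).
Proof.
rewrite sum_ffunE (big_lines fr) /= [X in _ + X]big1 ?addr0 => [|q _].
  by apply: eq_bigr => i _; rewrite !ffunE pencil_incident [_ *: _]mulr1.
by rewrite !ffunE (negPf (fline_incident _ _)) scaler0.
Qed.

(** What is retained of membership in the code. For a combination of lines, [s] is the total of the
    coefficients; those of the lines through [P] add up to [w P], which leaves [s - w P] for the
    others. *)
Definition pencil_word w (s : 'F_p) := forall P (fr : frame P),
  exists c h, (forall i y, w (fpoint fr i y) = pencil_fun c h i y) /\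
              \sum_q c q = s - w P.

Lemma code_pencil_word w : w \in code p -> exists s, pencil_word w s.
Proof.
case/codeP => c ->; exists (\sum_l c l) => P fr.
exists (c \o fline fr), (c \o pencil fr); split=> [i y|].
  exact: word_at_fpoint.
by rewrite (word_at_center c fr) (big_lines fr) /= [X in X - _]addrC addrK.
Qed.

Lemma line_sum w s l : pencil_word w s -> \sum_(X | incident X l) w X = s.
Proof.
move=> ws; have [P Pl] := line_has_point l; have [fr _] := frame_exists P.
have [i ->] := pencil_onto fr Pl; have [c [h [wE cE]]] := ws P fr.
have p2 := prime_gt1 p_prime.
rewrite big_pencil_points -[RHS](subrKC (w P)) -cE; congr (_ + _).
transitivity (moment (pencil_fun c h) 0 i).
  by apply: eq_bigr => y _; rewrite expr0 mulr1 wE.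
by rewrite moment_pencil_fun //; [apply: eq_bigr => q _; rewrite expr0 mulr1 | lia].
Qed.

(** A line missing the common point meets the support at most on [l] and [m], so the two values
    there add up to [s]; hence [w] is constant on each line off the common point. A third line
    through that point gives its value [s]. *)
Lemma word_on_two_lines w s l m : pencil_word w s -> l != m ->
  (forall X, w X != 0 -> incident X l || incident X m) ->
  exists a b : 'F_p, w = a *: line_fun l + b *: line_fun m.
Proof.
move=> ws; have [P [fr [i [j [-> ->]]]]] := lines_meet l m.
rewrite (inj_eq (@pencil_inj _ _ fr)) => ij wS.
have p2 := prime_gt1 p_prime.
have w0 k y : k != i -> k != j -> w (fpoint fr k y) = 0.
  move=> ki kj; apply/eqP; apply: contraT => /wS.
  by rewrite !incident_pencil (negPf ki) (negPf kj).
have wij y z : w (fpoint fr i y) + w (fpoint fr j z) = s.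
  have [q [qy qz]] := slope_eval_solve y z ij.
  rewrite -(line_sum (fline fr q) ws) big_fline_points (bigD1 i) //= qy.
  rewrite (bigD1 j) /= 1?eq_sym // qz big1 ?addr0 // => k /andP[ki kj].
  exact: w0.
have wP : w P = s.
  have /subsetPn[k _] : ~~ ([set: option 'F_p] \subset [set i; j]).
    apply/negP=> /subset_leq_card; rewrite cardsT card_pencil // cards2 ij.
    by lia.
  rewrite !inE negb_or => /andP[ki kj].
  rewrite -(line_sum (pencil fr k) ws) big_pencil_points /= big1 ?addr0 // => y _.
  exact: w0.
exists (w (fpoint fr i 0)), (w (fpoint fr j 0)); apply/ffunP => X; rewrite !ffunE.
have [->|/(fpoint_onto fr)[k [y ->]]] := eqVneq X P.
  by rewrite !pencil_incident wP -(wij 0 0) ![_ *: _]mulr1.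
rewrite !incident_pencil; have [->|ki] := eqVneq k i.
  rewrite (negPf ij) scaler0 addr0 [_ *: _]mulr1.
  by apply: (addIr (w (fpoint fr j 0))); rewrite !wij.
have [->|kj] := eqVneq k j; last by rewrite w0 // !scaler0 addr0.
rewrite scaler0 add0r [_ *: _]mulr1.
by apply: (addrI (w (fpoint fr i 0))); rewrite !wij.
Qed.

Definition on_two_lines w :=
  [exists l, exists m, forall X, (w X != 0) ==> incident X l || incident X m].

Lemma on_two_linesP w :
  reflect (exists l m, forall X, w X != 0 -> incident X l || incident X m)
          (on_two_lines w).
Proof.
apply: (iffP existsP) => [[l /existsP[m /forallP lm]]|[l [m lm]]].
  by exists l, m => X; apply/implyP.
by exists l; apply/existsP; exists m; apply/forallP=> X; apply/implyP/lm.
Qed.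

Definition line_weight w l := (\sum_(X | incident X l) (w X != 0%R))%N.

Definition pencil_count w P k := #|[set l | incident P l & line_weight w l == k]|.

Lemma hweightE w : hweight w = (\sum_X (w X != 0%R))%N.
Proof.
rewrite /hweight -sum1_card big_mkcond; apply: eq_bigr => X _.
by rewrite inE; case: eqP.
Qed.

Lemma fibre_weightE (g : option 'F_p -> 'F_p -> 'F_p) i :
  fibre_weight g i = (\sum_y (g i y != 0%R))%N.
Proof.
rewrite /fibre_weight -sum1_card big_mkcond; apply: eq_bigr => X _.
by rewrite inE; case: eqP.
Qed.

Lemma pencil_countE w P (fr : frame P) k :
  pencil_count w P k = #|[set i | line_weight w (pencil fr i) == k]|.
Proof.
rewrite -[RHS](card_imset _ (@pencil_inj _ _ fr)); congr #|pred_of_set _|.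
apply/setP=> l; rewrite !inE; apply/andP/imsetP => [[/(pencil_onto fr)[i ->]]|[i]].
  by move=> lk; exists i; rewrite ?inE.
by rewrite inE => lk ->; rewrite pencil_incident.
Qed.

(** Lines of weight [d] and [d.+1] through [P] carry no, respectively one, further support point.
    Off [P], the values on each line sum to [s - w P]: if this is zero, one further support point is
    impossible; otherwise none is impossible. The pencil lemmas bound the remaining count. *)
Lemma light_word_pencils w s P : (5 <= p)%N -> pencil_word w s ->
  (hweight w < 3 * p - 3)%N -> ~~ on_two_lines w ->
  let d := nat_of_bool (w P != 0) in
  if w P == s then (pencil_count w P d <= 1)%N /\ pencil_count w P d.+1 = 0%N
  else pencil_count w P d = 0%N /\ (pencil_count w P d.+1 <= 2)%N.
Proof.
move=> p5 ws wN w2 d; have [fr _] := frame_exists P.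
have [c [h [wE cE]]] := ws P fr; set g := pencil_fun c h in wE.
have dE i : line_weight w (pencil fr i) = (d + fibre_weight g i)%N.
  rewrite /line_weight big_pencil_points fibre_weightE; congr (_ + _)%N.
  by apply: eq_bigr => y _; rewrite wE.
have gN : (\sum_i fibre_weight g i < 3 * p - 3)%N.
  apply: leq_ltn_trans wN; rewrite hweightE (big_points fr) /=.
  apply: leq_trans (leq_addl _ _); apply: leq_sum => i _; rewrite fibre_weightE.
  by apply: leq_sum => y _; rewrite wE.
have cntE k : pencil_count w P (d + k)%N = #|[set i | fibre_weight g i == k]|.
  rewrite (pencil_countE w fr); congr #|pred_of_set _|; apply/setP=> i.
  by rewrite !inE dE eqn_add2l.
have cnt0 := cntE 0%N; have cnt1 := cntE 1%N; rewrite addn0 in cnt0.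
rewrite addn1 in cnt1; rewrite cnt0 cnt1.
have M0 i : \sum_y g i y = s - w P.
  rewrite -cE; transitivity (moment g 0 i).
    by apply: eq_bigr => y _; rewrite expr0 mulr1.
  by rewrite moment_pencil_fun //; [apply: eq_bigr => q _; rewrite expr0 mulr1 | lia].
have [wPs|wPs] := ifPn (w P == s).
  have {}cE : \sum_q c q = 0 by rewrite cE (eqP wPs) subrr.
  split; last first.
    apply/eqP; rewrite cards_eq0; apply/eqP/setP => i; rewrite !inE.
    apply/negP=> /cards1P[y /setP gy]; have gy0 : g i y != 0.
      by have := gy y; rewrite !inE eqxx.
    have := M0 i; rewrite (eqP wPs) subrr (bigD1 y) //= big1 ?addr0 => [/eqP|z zy].
      by rewrite (negPf gy0).
    by have := gy z; rewrite !inE (negPf zy) => /negbFE/eqP.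
  have [//|nz] := isotropic_pencil p_prime p5 cE gN; case/negP: w2; apply/on_two_linesP.
  have [i [j ij]] := card_le2_cover None nz.
  exists (pencil fr i), (pencil fr j) => X.
  have [->|/(fpoint_onto fr)[k [y ->]]] := eqVneq X P.
    by rewrite pencil_incident.
  rewrite wE !incident_pencil => gky; apply: ij; rewrite inE cards_eq0.
  by apply/set0Pn; exists y; rewrite inE.
have {}cE : \sum_q c q != 0 by rewrite cE subr_eq0 eq_sym.
split.
  apply/eqP; rewrite cards_eq0; apply/eqP/setP => i; rewrite !inE.
  apply/negP; rewrite cards_eq0 => /eqP/setP g0.
  have := M0 i; rewrite big1 => [/esym/eqP|y _].
    by rewrite subr_eq0 eq_sym (negPf wPs).
  by have := g0 y; rewrite !inE => /negbFE/eqP.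
have [//|[q qP]] := anisotropic_pencil p_prime p5 cE gN.
case/negP: w2; apply/on_two_linesP.
have [i iP] := card_le1_cover None qP.
exists (pencil fr i), (fline fr q) => X.
have [->|/(fpoint_onto fr)[k [y ->]]] := eqVneq X P.
  by rewrite pencil_incident.
rewrite wE incident_pencil incident_fline => gky.
have [//|yq] := eqVneq y (slope_eval k q); rewrite ?orbT //.
apply/orP; left; apply/eqP/iP; rewrite inE; apply/existsP; exists y.
by rewrite yq.
Qed.

(** * Double counting of incidences *)

Lemma exists_point : exists P : point p, True.
Proof.
have nz : const_mx 1 != 0 :> 'rV['F_p]_3.
  by apply/eqP=> /rowP/(_ 0); rewrite !mxE => /eqP; rewrite oner_eq0.
have dP : \dim <[const_mx 1 : 'rV['F_p]_3]> == 1%N by rewrite dim_vline nz.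
by exists (exist (fun U : {vspace 'rV['F_p]_3} => \dim U == 1%N) _ dP).
Qed.

Lemma card_point : #|point p| = (p * p + p + 1)%N.
Proof.
have [P _] := exists_point; have [fr _] := frame_exists P.
rewrite -sum1_card (big_points fr) /=.
under eq_bigr do rewrite sum_nat_const card_Fp // muln1.
by rewrite sum_nat_const card_pencil //; lia.
Qed.

Lemma sum_points_on_line l : (\sum_(X | incident X l) 1 = p.+1)%N.
Proof.
have [P Pl] := line_has_point l; have [fr _] := frame_exists P.
have [i ->] := pencil_onto fr Pl.
by rewrite big_pencil_points /= sum_nat_const card_Fp // muln1.
Qed.

Lemma sum_lines_through P (m : nat) : (\sum_(l | incident P l) m = m * p.+1)%N.
Proof.
have [fr _] := frame_exists P.
by rewrite (big_pencil fr) sum_nat_const card_pencil // mulnC.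
Qed.

Lemma sum_line_weight w P :
  (\sum_(l | incident P l) line_weight w l = hweight w + p * (w P != 0%R))%N.
Proof.
have [fr _] := frame_exists P.
rewrite (big_pencil fr) hweightE (big_points fr) /= /line_weight.
under eq_bigr do rewrite big_pencil_points /=.
by rewrite big_split /= sum_nat_const card_pencil //; lia.
Qed.

Lemma sum_pencil_count w P (m k : nat) :
  (\sum_(l | incident P l) m * (line_weight w l == k) = m * pencil_count w P k)%N.
Proof.
rewrite -big_distrr; congr (_ * _)%N.
rewrite /pencil_count -sum1_card [RHS]big_mkcond [LHS]big_mkcond /=.
by apply: eq_bigr => l _; rewrite inE; case: incident; case: eqP.
Qed.

Lemma double_count (Z : pred (point p)) (f : line p -> nat) :
  (\sum_(X | Z X) \sum_(l | incident X l) f l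
    = \sum_l f l * \sum_(X | incident X l) Z X)%N.
Proof.
rewrite (exchange_big_dep xpredT) //=; apply: eq_bigr => l _.
rewrite sum_nat_const mulnC -sum1_card big_mkcond [in RHS]big_mkcond /=.
congr (_ * _)%N; apply: eq_bigr => X _; rewrite unfold_in /=.
by case: (Z X); case: incident.
Qed.

Lemma light_word_on_two_lines w s : (5 <= p)%N -> pencil_word w s ->
  (hweight w < 3 * p - 3)%N -> on_two_lines w.
Proof.
move=> p5 ws wN; apply: contraT => w2.
have key P := light_word_pencils P p5 ws wN w2.
pose n := hweight w; pose lw := line_weight w.
(* [f] is the deficiency [3 - lw l] of the lines carrying one or two support
   points, and [f'] is chosen so that [2 * f l * (p + 1 - lw l) = f' l * lw l]. *)
pose f l := (2 * (lw l == 1) + (lw l == 2))%N.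
pose f' l := (4 * p * (lw l == 1) + (p - 1) * (lw l == 2))%N.
(* Off the support, the deficiencies add up to at least [3(p+1) - (3p-4) = 7], less [3] for the one
   empty line possible when [s = 0]. At a support point, [s = 0] allows two lines of weight 2;
   otherwise the worst case is one line of weight 1. *)
pose A := (if s == 0%R then 4 else 7)%N.
pose B := (if s == 0%R then 2 * (p - 1) else 4 * p)%N.
have fA P : w P == 0 -> (A <= \sum_(l | incident P l) f l)%N.
  move=> wP; have := key P; rewrite /= wP /= (eqP wP) eq_sym /A.
  have : (\sum_(l | incident P l) 3 <=
      \sum_(l | incident P l) (lw l + 3 * (lw l == 0) + f l))%N.
    by apply: leq_sum => l _; rewrite /f; case: (lw l) => [|[|[|]]].
  rewrite /lw big_split /= big_split /= sum_line_weight wP sum_pencil_count.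
  rewrite sum_lines_through.
  by case: ifP => _ H [H1 H2]; move: H; rewrite -/n; lia.
have fB P : w P != 0 -> (\sum_(l | incident P l) f' l <= B)%N.
  move=> wP; have := key P; rewrite wP /B /f' /lw big_split /= !sum_pencil_count.
  have [s0|s0] := eqVneq s 0.
    by rewrite s0 (negPf wP) => -[-> H]; nia.
  by case: ifP => _ [H1 H2]; nia.
have count : (2 * (A * (p * p + p + 1 - n)) <= B * n)%N.
  have nE : (n = \sum_(X | w X != 0%R) 1)%N.
    by rewrite /n /hweight -sum1_card; apply: eq_bigl => X; rewrite inE.
  have -> : (p * p + p + 1 - n = \sum_(X | w X == 0%R) 1)%N.
    by rewrite -card_point -sum1_card (bigID (fun X => w X == 0)) /= nE addnK.
  rewrite nE.
  rewrite !big_distrr /= !muln1.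
  apply: (@leq_trans (\sum_(X | w X == 0%R) 2 * \sum_(l | incident X l) f l)%N).
    by apply: leq_sum => X /fA; lia.
  apply: (@leq_trans (\sum_(X | w X != 0%R) \sum_(l | incident X l) f' l)%N);
    last exact: leq_sum.
  rewrite -big_distrr /= !double_count big_distrr /=; apply: leq_sum => l _.
  have : (lw l + \sum_(X | incident X l) (w X == 0%R) = p.+1)%N.
    rewrite -(sum_points_on_line l) -big_split; apply: eq_bigr => X _ /=.
    by case: eqP.
  rewrite -/(line_weight w l) -/(lw l) /f /f'; move: (lw l) (\sum_(X | _) _)%N => a b.
  by case: a => [|[|[|]]] //= [<-]; nia.
have nN : (n <= 3 * p - 4)%N by rewrite /n; lia.
(* The factors [4p + 14] and [2p + 6] are the coefficients of [n] in [count] once its terms are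
   collected, for [s != 0] and (after moving [8n] across) for [s = 0]. *)
have : ((4 * p + 14) * n <= (4 * p + 14) * (3 * p - 4))%N by rewrite leq_mul2l nN orbT.
have : ((2 * p + 6) * n <= (2 * p + 6) * (3 * p - 4))%N by rewrite leq_mul2l nN orbT.
by move: count; rewrite /A /B; case: ifP => _; nia.
Qed.
End Words.

(** * Combinations of two lines *)

Section TwoLines.
Variables (p : nat) (p_prime : prime p).
Implicit Types (w : fspace p) (l m : line p) (P Q : point p).

Lemma exists_line : exists l : line p, True.
Proof.
have [P _] := exists_point p; have [fr _] := frame_exists P.
by exists (pencil fr None).
Qed.

(** Zero coefficients are allowed, so a smaller set of lines can be padded to two distinct ones. *)
Lemma comb_of_two_linesP w :
  comb_of_lines 2 w <->
  exists l m (a b : 'F_p), l != m /\ w = a *: line_fun l + b *: line_fun m.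
Proof.
split=> [[S [c [S2 ->]]]|[l [m [a [b [lm ->]]]]]]; last first.
  exists [set l; m], (fun k => if k == l then a else b); rewrite cards2 lm; split=> //.
  by rewrite big_setU1 ?inE //= big_set1 eqxx eq_sym (negPf lm).
have [l0 _] := exists_line; have [l [m' Sm']] := card_le2_cover l0 S2.
have [m [lm Sm]] : exists m, l != m /\ forall z, z \in S -> (z == l) || (z == m).
  have [lm'|lm'] := eqVneq l m'; last by exists m'.
  have [m ml] := exists_other_line l; exists m; split=> [|z /Sm' zS].
    by apply: contraNneq ml => ->.
  by apply/orP; left; apply/eqP; case/orP: zS => /eqP->.
exists l, m, (if l \in S then c l else 0), (if m \in S then c m else 0); split=> //.
rewrite big_mkcond (bigD1 l) //= (bigD1 m) /= 1?eq_sym //.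
rewrite big1 ?addr0 => [|k /andP[kl km]].
  by congr (_ + _); case: ifP; rewrite ?scale0r.
by case: ifP => // /Sm; rewrite (negPf kl) (negPf km).
Qed.

Lemma two_linesE l m (a b : 'F_p) X :
  (a *: line_fun l + b *: line_fun m) X
    = a * (incident X l)%:R + b * (incident X m)%:R :> 'F_p.
Proof. by rewrite !ffunE. Qed.

(** The value is [a + b] at the common point, and [a] or [b] at the [p] other points of each
    line. *)
Lemma hweight_two_lines l m (a b : 'F_p) : l != m ->
  hweight (a *: line_fun l + b *: line_fun m)
    = (((a + b)%R != 0%R) + (p * (a != 0%R) + p * (b != 0%R)))%N.
Proof.
have [P [fr [i [j [-> ->]]]]] := lines_meet l m.
rewrite (inj_eq (@pencil_inj _ _ fr)) => ij; rewrite hweightE (big_points fr) /=.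
congr (_ + _)%N; first by rewrite two_linesE !pencil_incident !mulr1.
have wE k y : (a *: line_fun (pencil fr i) + b *: line_fun (pencil fr j)) (fpoint fr k y)
    = a * (k == i)%:R + b * (k == j)%:R :> 'F_p.
  by rewrite two_linesE !incident_pencil.
rewrite (bigD1 i) //= (bigD1 j) /=; last by rewrite eq_sym.
rewrite [X in (_ + (_ + X))%N]big1 ?addn0 => [|k /andP[ki kj]]; last first.
  by apply: big1 => y _; rewrite wE (negPf ki) (negPf kj) !mulr0 addr0 eqxx.
have sumE n : (p * n = \sum_(y : 'F_p) n)%N by rewrite sum_nat_const card_Fp.
congr (_ + _)%N; rewrite sumE; apply: eq_bigr => y _.
  by rewrite wE eqxx (negPf ij) mulr0 addr0 mulr1.
by rewrite wE eqxx [j == i]eq_sym (negPf ij) mulr0 add0r mulr1.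
Qed.

End TwoLines.

(** * A word of weight [3p-3] *)

Section CarryWord.
Variables (p : nat) (p_prime : prime p).

(** Parametrizes by [t] the [p] lines through [fpoint i y] that miss the centre. *)
Definition slope_param i (y t : 'F_p) : 'F_p * 'F_p :=
  if i is Some r then (y - r * t, t) else (t, y).

Lemma sum_slope_param (G : 'F_p * 'F_p -> 'F_p) i y :
  \sum_q G q * (y == slope_eval i q)%:R = \sum_t G (slope_param i y t).
Proof.
rewrite (eq_bigr (fun q => G (q.1, q.2) * (y == slope_eval i (q.1, q.2))%:R));
  last by case.
rewrite -(pair_bigA _ (fun a b => G (a, b) * (y == slope_eval i (a, b))%:R)) /=.
case: i => [r|] /=.
  rewrite exchange_big; apply: eq_bigr => b _ /=.
  rewrite (bigD1 (y - r * b)) //= subrK eqxx mulr1 big1 ?addr0 // => a ay.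
  by rewrite -subr_eq eq_sym (negPf ay) mulr0.
apply: eq_bigr => a _; rewrite (bigD1 y) //= eqxx mulr1 big1 ?addr0 // => b /negPf.
by rewrite eq_sym => ->; rewrite mulr0.
Qed.

Lemma ltn_Fp (x : 'F_p) : (x < p)%N.
Proof. by have := ltn_ord x; rewrite [X in (_ < X)%N -> _]Fp_cast. Qed.

Definition carry (q : 'F_p * 'F_p) : nat := (p <= q.1 + q.2)%N.

(* Summing this identity over the slopes of the lines through a given point
   counts the carries there, since affine maps permute the residues. *)
Lemma carryE (q : 'F_p * 'F_p) :
  (q.1 + q.2 = (q.1 + q.2)%R + p * carry q :> nat)%N.
Proof.
have -> : ((q.1 + q.2)%R = (q.1 + q.2) %% p :> nat)%N.
  by transitivity ((q.1 + q.2) %% (Zp_trunc (pdiv p)).+2)%N => //;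
    congr (_ %% _)%N; apply: Fp_cast.
have := ltn_Fp q.1; have := ltn_Fp q.2; rewrite /carry.
move: (q.1 : nat) (q.2 : nat) => a b bp ap.
case: leqP => h; last by rewrite modn_small; lia.
rewrite -{2}(subnK h) modnDr modn_small; lia.
Qed.

Lemma sum_Fp_val : (2 * \sum_(t : 'F_p) t = p * (p - 1))%N.
Proof.
have -> : (\sum_(t : 'F_p) t = \sum_(0 <= i < p) i)%N.
  by rewrite -[in RHS](Fp_cast p_prime) big_mkord.
elim: p => [|n IH]; first by rewrite big_geq.
by rewrite big_nat_recr //= mulnDr IH; nia.
Qed.

Lemma sum_affine_val (a b : 'F_p) : a != 0 ->
  (\sum_(t : 'F_p) (b + a * t)%R = \sum_(t : 'F_p) t)%N.
Proof.
move=> a0; rewrite [RHS](reindex_inj (addrI b)) /= [RHS](reindex_inj (mulfI a0)).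
by [].
Qed.

Lemma sum_const_val (y : 'F_p) : (\sum_(t : 'F_p) y = p * y)%N.
Proof. by rewrite sum_nat_const card_Fp. Qed.

(** For slopes other than [0], [1] and infinity, the number of carries is [(p-1)/2], that is [-1/2]
    modulo [p]; at slope [1] it is [p - 1 - y], and the correction leaves [- y]. *)
Definition carry_corr (i : option 'F_p) : 'F_p :=
  if i is Some r then if r == 0 then 0 else if r == 1 then 1 else 2%:R^-1 else 0.

Definition carry_fibre (i : option 'F_p) (y : 'F_p) : 'F_p :=
  if i is Some r then if r == 0 then y else if r == 1 then - y else 0 else y.

Lemma two_neq0 : (2 < p)%N -> 2%:R != 0 :> 'F_p.
Proof. by move=> p2; rewrite -(dvdn_pcharf (pchar_Fp p_prime)) gtnNdvd. Qed.

Lemma carry_fibreE i y : (2 < p)%N ->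
  pencil_fun (fun q => (carry q)%:R) carry_corr i y = carry_fibre i y.
Proof.
move=> p2; rewrite /pencil_fun sum_slope_param -natr_sum.
set K := (\sum_(t : 'F_p) carry (slope_param i y t))%N.
have p0 := prime_gt0 p_prime.
(* Each of the three sums of residues is over a permutation of the field, giving [T], or over a
   constant, giving [p] times it; solving for [K] counts the carries. *)
have KE : (\sum_(t : 'F_p) (slope_param i y t).1 + \sum_(t : 'F_p) (slope_param i y t).2
    = \sum_(t : 'F_p) ((slope_param i y t).1 + (slope_param i y t).2)%R + p * K)%N.
  by rewrite big_distrr -!big_split; apply: eq_bigr => t _; apply: carryE.
have T2 := sum_Fp_val; set T := (\sum_(t : 'F_p) t)%N in T2.
have yE : (y : nat)%:R = y by rewrite natr_Zp.
case: i K KE => [r|] K /=; last first.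
  rewrite sum_const_val.
  have -> : (\sum_(t : 'F_p) (t + y)%R = T)%N.
    by rewrite /T [RHS](reindex_inj (addIr y)).
  by rewrite -/T => /addnI/eqP; rewrite eqn_pmul2l // => /eqP<-; rewrite add0r yE.
have -> : (\sum_(t : 'F_p) (y - r * t + t)%R = \sum_(t : 'F_p) (y + (1 - r) * t)%R)%N.
  by apply: eq_bigr => t _; congr nat_of_ord; ring.
have -> : (\sum_(t : 'F_p) (y - r * t)%R = \sum_(t : 'F_p) (y + (- r) * t)%R)%N.
  by apply: eq_bigr => t _; congr nat_of_ord; ring.
rewrite -/T; have [->|r0] := eqVneq r 0.
  rewrite [X in _ = (X + _)%N]sum_affine_val ?subr0 ?oner_eq0 // -/T.
  under eq_bigr do rewrite oppr0 mul0r addr0.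
  rewrite sum_const_val addnC => /addnI/eqP; rewrite eqn_pmul2l // => /eqP<-.
  by rewrite add0r yE.
rewrite sum_affine_val ?oppr_eq0 // -/T; have [->|r1] := eqVneq r 1.
  under eq_bigr do rewrite subrr mul0r addr0.
  rewrite sum_const_val => KE.
  have yp := ltn_Fp y.
  have {}KE : (K + y + 1 = p)%N by nia.
  have : (K + y + 1)%:R = 0 :> 'F_p by rewrite KE pchar_Fp_0.
  by rewrite !natrD yE => H; apply/eqP; rewrite -subr_eq0 opprK -H; apply/eqP; ring.
rewrite sum_affine_val; last by rewrite subr_eq0 eq_sym.
rewrite -/T => KE; have {}KE : (2 * K + 1 = p)%N by nia.
have H : (2 * K + 1)%:R = 0 :> 'F_p by rewrite KE pchar_Fp_0.
have n2 := two_neq0 p2.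
apply: (mulfI n2); rewrite mulr0 mulrDr mulfV // -H natrD natrM; ring.
Qed.

(** This makes the word vanish at the centre. The constant [1/2] sums to zero over the field, and
    its values at [0] and [1] have the same total as the corrections [0] and [1]. *)
Lemma sum_carry_corr : (2 < p)%N -> \sum_i carry_corr i = 0.
Proof.
move=> p2; rewrite big_option /= add0r (bigD1 0) //= ?eqxx add0r.
have [o0 n2] := (oner_neq0 'F_p, two_neq0 p2).
rewrite (bigD1 1) //= ?(negPf o0) ?eqxx.
have : \sum_(r : 'F_p) 2%:R^-1 = 0 :> 'F_p.
  by rewrite sumr_const card_Fp // -[_ *+ p]mulr_natr pchar_Fp_0 // mulr0.
rewrite (bigD1 0) //= (bigD1 1) //= addrA.
have -> : 2%:R^-1 + 2%:R^-1 = 1 :> 'F_p by field.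
move=> E; rewrite -[RHS]E; congr (_ + _); apply: eq_bigr => r /andP[r0 r1].
by rewrite (negPf r0) (negPf r1).
Qed.

Lemma carry_word : (2 < p)%N ->
  exists2 w : fspace p, w \in code p & hweight w = (3 * p - 3)%N.
Proof.
move=> p2; have [P _] := exists_point p; have [fr _] := frame_exists P.
pose w : fspace p := \sum_q (carry q)%:R *: line_fun (fline fr q)
  + \sum_i carry_corr i *: line_fun (pencil fr i).
have lC l : line_fun l \in code p by rewrite memv_span // map_f // mem_enum.
have wP : w P = 0.
  rewrite ffunE !sum_ffunE big1 => [|q _]; last first.
    by rewrite !ffunE (negPf (fline_incident _ _)) scaler0.
  rewrite add0r -[RHS](sum_carry_corr p2); apply: eq_bigr => i _.
  by rewrite !ffunE pencil_incident [_ *: _]mulr1.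
have wE i y : w (fpoint fr i y) = carry_fibre i y.
  rewrite -(carry_fibreE i y p2) ffunE !sum_ffunE addrC; congr (_ + _).
    rewrite (bigD1 i) //= big1 ?addr0 => [|j ji].
      by rewrite !ffunE incident_pencil eqxx [_ *: _]mulr1.
    by rewrite !ffunE incident_pencil eq_sym (negPf ji) scaler0.
  by apply: eq_bigr => q _; rewrite !ffunE incident_fline.
exists w; first by rewrite memvD // memv_suml // => i _; rewrite memvZ.
rewrite hweightE (big_points fr) wP eqxx /= add0n.
have E : (\sum_(y : 'F_p) (y != 0%R) = p - 1)%N.
  rewrite (bigD1 0) //= ?eqxx add0n (eq_bigr (fun=> 1%N)) => [|y ->] //.
  by rewrite sum1_card cardC1 card_Fp // subn1.
rewrite (eq_bigr (fun i => \sum_y (carry_fibre i y != 0%R)))%N => [|i _]; last first.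
  by apply: eq_bigr => y _; rewrite wE.
rewrite big_option /= E (bigD1 0) //= ?eqxx E (bigD1 1) //= ?oner_eq0 ?eqxx.
under eq_bigr do rewrite oppr_eq0.
rewrite E big1 => [|r /andP[/negPf r0 /negPf r1]]; first by lia.
by rewrite r0 r1 big1 // => y _; rewrite eqxx.
Qed.

End CarryWord.

(** * The list of the smallest weights *)

Lemma sorted_ltn_cat (s : seq nat) (d : nat) : sorted ltn s ->
  s = [seq x <- s | (x <= d)%N] ++ [seq x <- s | (d < x)%N].
Proof.
elim: s => //= x s IH xs; have s_gt := order_path_min ltn_trans xs.
case: leqP => xd /=; first by rewrite -IH // (path_sorted xs).
rewrite (eq_in_filter (a2 := pred0)) ?filter_pred0 => [|y /(allP s_gt) /= xy]; last first.
  by apply/negbTE; rewrite -ltnNge (ltn_trans xd).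
rewrite (eq_in_filter (a2 := predT)) ?filter_predT // => y /(allP s_gt) /= xy.
exact: ltn_trans xy.
Qed.

(** The entries of [s] up to [d] form a prefix of [s], and a strictly increasing list is determined
    by its elements. *)
Lemma take_sorted (s t : seq nat) (d : nat) :
  sorted ltn s -> sorted ltn t -> all (fun x => (x <= d)%N) t ->
  {subset t <= s} -> (forall x, x \in s -> (x <= d)%N -> x \in t) ->
  take (size t) s = t.
Proof.
move=> sS tS td ts st.
have fE : [seq x <- s | (x <= d)%N] = t.
  apply: (irr_sorted_eq ltn_trans ltnn) => //.
    by apply: sorted_filter => //; apply: ltn_trans.
  move=> x; rewrite mem_filter; apply/andP/idP => [[xd xs]|xt]; first exact: st.
  by split; [apply: (allP td) | apply: ts].
by rewrite (sorted_ltn_cat d sS) fE take_size_cat.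
Qed.

Section LightWords.
Variables (p : nat) (p_prime : prime p) (p_ge5 : (5 <= p)%N).

Lemma light_word_comb (w : fspace p) : w \in code p ->
  ((hweight w < 3 * p - 3)%N <-> comb_of_lines 2 w).
Proof.
move=> wC; split=> [wN|/comb_of_two_linesP[l [m [a [b [lm ->]]]]]]; last first.
  (* The weight is at most [2p + 1], which is less than [3p - 3] since [p >= 5]. *)
  rewrite hweight_two_lines //.
  by case: (a + b != 0); case: (a != 0); case: (b != 0); lia.
have [s ws] := code_pencil_word wC.
have /on_two_linesP[l [m' lm']] := light_word_on_two_lines p_prime p_ge5 ws wN.
have [m [lm Sm]] : exists m, l != m /\ forall X, w X != 0 -> incident X l || incident X m.
  have [E|lm] := eqVneq l m'; last by exists m'.
  have [m ml] := exists_other_line l; exists m; split=> [|X /lm' XS].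
    by apply: contraNneq ml => ->.
  by apply/orP; left; case/orP: XS => //; rewrite E.
have [a [b wE]] := word_on_two_lines p_prime ws lm Sm.
by apply/comb_of_two_linesP; exists l, m, a, b.
Qed.

Lemma mem_nonzero_weights k : (0 < k)%N ->
  reflect (exists2 w : fspace p, w \in code p & hweight w = k) (k \in nonzero_weights p).
Proof.
move=> k0; rewrite mem_sort mem_undup; apply: (iffP imageP) => [[w]|[w wC wk]].
  by rewrite inE => /andP[wC _] ->; exists w.
exists w => //; rewrite inE wC; apply: contraTneq k0 => w0.
by rewrite -wk w0 hweightE big1 // => X _; rewrite ffunE eqxx.
Qed.

End LightWords.

Local Close Scope ring_scope.

Theorem theorem1p1 (p : nat) (p_prime : prime p) (p_ge5 : 5 <= p) :
  [/\ nth 0 (nonzero_weights p) 3 = 3 * p - 3,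
      take 4 (nonzero_weights p) = [:: p + 1; 2 * p; 2 * p + 1; 3 * p - 3]
    & forall w : fspace p, w \in code p ->
        (hweight w < 3 * p - 3 <-> comb_of_lines 2 w)].
Proof.
have comb w := @light_word_comb p p_prime p_ge5 w.
have p0 : 0 < p := prime_gt0 p_prime.
have [l0 _] := exists_line p; have [m0 ml0] := exists_other_line l0.
have lC (a b : 'F_p) : (a *: line_fun l0 + b *: line_fun m0)%R \in code p.
  by rewrite memvD // memvZ // memv_span // map_f // mem_enum.
have two (a b : 'F_p) k : 0 < k ->
    ((a + b)%R != 0%R) + (p * (a != 0%R) + p * (b != 0%R)) = k ->
    k \in nonzero_weights p.
  move=> k0 kE; apply/mem_nonzero_weights => //.
  exists (a *: line_fun l0 + b *: line_fun m0)%R => //.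
  by rewrite hweight_two_lines // eq_sym.
have o0 := oner_neq0 'F_p.
have take4 : take 4 (nonzero_weights p) = [:: p + 1; 2 * p; 2 * p + 1; 3 * p - 3].
  apply: (@take_sorted _ [:: p + 1; 2 * p; 2 * p + 1; 3 * p - 3] (3 * p - 3)).
  - by rewrite ltn_sorted_uniq_leq sort_uniq undup_uniq sort_sorted //; apply: leq_total.
  - by rewrite /=; lia.
  - by rewrite /=; lia.
  (* The weights are attained by a line, a difference of two lines, a sum of two lines (as
     [2 != 0]), and the carry word. *)
  - move=> k; rewrite !inE => /or4P[]/eqP->.
    + by apply: (two 1%R 0%R); rewrite ?addr0 ?o0 ?eqxx /=; lia.
    + by apply: (two 1%R (-1)%R); rewrite ?subrr ?oppr_eq0 ?o0 ?eqxx /=; lia.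
    + apply: (two 1%R 1%R); first by lia.
      have /negPf-> : (1 + 1)%R != 0%R :> 'F_p by apply: (two_neq0 p_prime); lia.
      by rewrite o0 /=; lia.
    + apply/mem_nonzero_weights; first by lia.
      by apply: carry_word => //; lia.
  - move=> k kW; rewrite leq_eqVlt => /orP[/eqP->|kN]; first by rewrite !inE eqxx !orbT.
    move: kW kN; rewrite mem_sort mem_undup => /imageP[w].
    rewrite inE => /andP[wC w0] -> /(comb w wC).
    move/comb_of_two_linesP => [l [m [a [b [lm wE]]]]].
    move: w0; rewrite wE hweight_two_lines //; have [->|a0] := eqVneq a 0%R.
      have [->|b0 _] := eqVneq b 0%R; first by rewrite !scale0r addr0 eqxx.
      by rewrite add0r b0 !inE /= muln0 add0n muln1 addnC eqxx.
    have [->|b0 _] := eqVneq b 0%R => [_|].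
      by rewrite addr0 a0 !inE /= muln0 addn0 muln1 addnC eqxx.
    by rewrite !inE; case: ((a + b)%R != 0%R); lia.
split; last by [].
- by rewrite -(nth_take _ (isT : 3 < 4)) take4.
- by [].
Qed.
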